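(* (1) Let $M$ be a finite minimal meadow with cardinality $n$. Then there are distinct primes $p_1,\ldots,p_k$ ($k\ge 0$) such that $$M\cong \mathbb{Z}/p_1\mathbb{Z}\times\cdots\times\mathbb{Z}/p_k\mathbb{Z}$$ as meadows (operations on the product defined componentwise) and $n=p_1\cdots p_k$. (2) Any two finite minimal meadows with the same number of elements are isomorphic as meadows.
   Context: A meadow is a commutative ring with identity element $1$ (it is not required that $0\neq 1$) equipped with a total unary operation ${}^{-1}$ satisfying, for all $x$, $(x^{-1})^{-1}=x$ and $x\cdot(x\cdot x^{-1})=x$. A submeadow is a subset containing $0,1$ and closed under $+,-,\cdot,{}^{-1}$. A meadow is minimal if it contains no proper submeadows. For a prime $p$, $\mathbb{Z}/p\mathbb{Z}$ is viewed as a meadow by letting ${}^{-1}$ be the usual inverse on nonzero elements and $0^{-1}=0$. Isomorphism of meadows means a bijection preserving $0,1,+,-,\cdot,{}^{-1}$. The empty product ($k=0$) is the one-element meadow. *)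

(* Defs.v *)
From HB Require Import structures.
From mathcomp Require Import all_boot all_order all_algebra.

Set Implicit Arguments.
Unset Strict Implicit.
Unset Printing Implicit Defensive.

Import GRing.Theory.
Local Open Scope ring_scope.

(* The base structure is comPzRingType, which does not require 0 != 1, so the
   one-element ring is allowed. *)
HB.mixin Record isMeadow M of GRing.ComPzRing M := {
  minv : M -> M;
  minvK : involutive minv;
  mulr_mulrV : forall x : M, x * (x * minv x) = x
}.

#[short(type="meadowType")]
HB.structure Definition Meadow := {M of GRing.ComPzRing M & isMeadow M}.

#[short(type="finMeadowType")]
HB.structure Definition FinMeadow := {M of Meadow M & Finite M}.

Record submeadow (M : meadowType) (S : M -> Prop) : Prop := Submeadow {
  submeadow0 : S 0;
  submeadow1 : S 1;
  submeadowD : forall x y, S x -> S y -> S (x + y);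
  submeadowN : forall x, S x -> S (- x);
  submeadowM : forall x y, S x -> S y -> S (x * y);
  submeadowV : forall x, S x -> S (minv x)
}.

Definition minimal_meadow (M : meadowType) : Prop :=
  ~ exists S : M -> Prop, submeadow S /\ exists x, ~ S x.

Record meadow_iso (M N : meadowType) (f : M -> N) : Prop := MeadowIso {
  meadow_iso_bij : bijective f;
  meadow_iso0 : f 0 = 0;
  meadow_iso1 : f 1 = 1;
  meadow_isoD : {morph f : x y / x + y};
  meadow_isoN : {morph f : x / - x};
  meadow_isoM : {morph f : x y / x * y};
  meadow_isoV : {morph f : x / minv x}
}.

Definition isomorphic_meadows (M N : meadowType) : Prop :=
  exists f : M -> N, meadow_iso f.

(* Z/pZ as a meadow, for p prime ('F_p is the ring of integers modulo the
   smallest prime divisor of p, hence modulo p only in that case).  The inverse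
   of a MathComp field is total and satisfies 0^-1 = 0 (invr0). *)
Definition Zmodp (p : nat) : Type := 'F_p.

Section ZmodpMeadow.
Variable p : nat.

Fact Zmodp_mulr_mulrV (x : 'F_p) : x * (x * x^-1) = x.
Proof.
have [->|x0] := eqVneq x 0; first by rewrite mul0r.
by rewrite divff // mulr1.
Qed.

HB.instance Definition _ := GRing.ComPzRing.copy (Zmodp p) 'F_p.
HB.instance Definition _ := Finite.copy (Zmodp p) 'F_p.
HB.instance Definition _ :=
  isMeadow.Build (Zmodp p) (@invrK 'F_p) Zmodp_mulr_mulrV.

End ZmodpMeadow.

(* The product of a finite family of meadows, with componentwise operations;
   for empty I it has exactly one element. *)
Definition meadow_prod (I : finType) (T : I -> meadowType) : Type :=
  {dffun forall i : I, T i}.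

Section MeadowProd.
Variables (I : finType) (T : I -> meadowType).
Local Notation P := (meadow_prod T).
Implicit Types f g h : P.

HB.instance Definition _ := Choice.copy P {dffun forall i : I, T i}.

Definition mprod_zero : P := [ffun i => 0 : T i].
Definition mprod_one : P := [ffun i => 1 : T i].
Definition mprod_add f g : P := [ffun i => f i + g i : T i].
Definition mprod_opp f : P := [ffun i => - f i : T i].
Definition mprod_mul f g : P := [ffun i => f i * g i : T i].
Definition mprod_inv f : P := [ffun i => minv (f i) : T i].

Fact mprod_addA : associative mprod_add.
Proof. by move=> f g h; apply/ffunP=> i; rewrite !ffunE addrA. Qed.
Fact mprod_addC : commutative mprod_add.
Proof. by move=> f g; apply/ffunP=> i; rewrite !ffunE addrC. Qed.
Fact mprod_add0 : left_id mprod_zero mprod_add.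
Proof. by move=> f; apply/ffunP=> i; rewrite !ffunE add0r. Qed.
Fact mprod_addN : left_inverse mprod_zero mprod_opp mprod_add.
Proof. by move=> f; apply/ffunP=> i; rewrite !ffunE addNr. Qed.

HB.instance Definition _ :=
  GRing.isZmodule.Build P mprod_addA mprod_addC mprod_add0 mprod_addN.

Fact mprod_mulA : associative mprod_mul.
Proof. by move=> f g h; apply/ffunP=> i; rewrite !ffunE mulrA. Qed.
Fact mprod_mulC : commutative mprod_mul.
Proof. by move=> f g; apply/ffunP=> i; rewrite !ffunE mulrC. Qed.
Fact mprod_mul1 : left_id mprod_one mprod_mul.
Proof. by move=> f; apply/ffunP=> i; rewrite !ffunE mul1r. Qed.
Fact mprod_mulDl : left_distributive mprod_mul mprod_add.
Proof. by move=> f g h; apply/ffunP=> i; rewrite !ffunE mulrDl. Qed.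

HB.instance Definition _ := GRing.Zmodule_isComPzRing.Build P
  mprod_mulA mprod_mulC mprod_mul1 mprod_mulDl.

Fact mprod_invK : involutive mprod_inv.
Proof. by move=> f; apply/ffunP=> i; rewrite !ffunE minvK. Qed.
Fact mprod_mulr_mulrV f : f * (f * mprod_inv f) = f.
Proof. by apply/ffunP=> i; rewrite !ffunE mulr_mulrV. Qed.

HB.instance Definition _ := isMeadow.Build P mprod_invK mprod_mulr_mulrV.

End MeadowProd.

(* Main.v *)
Require Import Defs.
From mathcomp Require Import all_boot all_order all_algebra.

(** A finite minimal meadow is the ring of integers modulo a squarefree number,
    and everything follows from that.

    In any meadow the inverse of [x] is the only [y] with [x * (x * y) = x] and
    [y * (y * x) = y] ([minv_unique]).  If the meadow is finite, the powers of
    [x] repeat, and the defining equation cancels a common factor as long as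
    one [x] is left over, so [x ^+ b.+1 = x] for some [b > 0]
    ([expr_period]).  Hence the inverse of [x] is itself a power of [x]
    ([minv_expr]), and every subring of a finite meadow is a submeadow.
    Minimality then forces the meadow to coincide with its prime subring: each
    element is some [m%:R] ([minimal_natr]), and [m%:R = 0] exactly when the
    cardinality divides [m] ([minimal_natr_eq0]).  Since a nonzero element of a
    meadow has a nonzero square, the cardinality is squarefree
    ([minimal_logn]).

    A ring whose elements are all of the form [m%:R] embeds in another ring as
    soon as the same multiples of [1] vanish on both sides, and by uniqueness
    of inverses the embedding preserves inverses as well
    ([minimal_isomorphic]).  An injection between finite sets of equal size is
    bijective, which gives at once the isomorphism of two minimal meadows of
    equal cardinality and the decomposition: in the product of the fields
    [Z/pZ], for [p] ranging over the prime divisors of the squarefree number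
    [n], the element [m%:R] vanishes exactly when all these primes divide [m],
    that is, when [n] does. *)

Set Implicit Arguments.
Unset Strict Implicit.
Unset Printing Implicit Defensive.

Import GRing.Theory.

Section Meadows.

Local Open Scope ring_scope.

(** Both [y] and [minv x] are equal to [y * x * minv x]. *)
Lemma minv_unique (M : meadowType) (x y : M) :
  x * (x * y) = x -> y * (y * x) = y -> y = minv x.
Proof.
have half (a b c : M) : b * (b * a) = b -> a * (a * c) = a -> b = b * (a * c).
  by move=> bba aac; rewrite -{1}bba -{1}aac !mulrA -(mulrA b b a) bba.
move=> xxy yyx; have xxz := mulr_mulrV x; have := mulr_mulrV (minv x).
rewrite minvK => zzx.
by rewrite (half x y _ yyx xxz) [RHS](half x _ y zzx xxy) mulrCA [RHS]mulrC mulrA.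
Qed.

Lemma sqr_eq0 (M : meadowType) (x : M) : x * x = 0 -> x = 0.
Proof. by move=> xx; rewrite -(mulr_mulrV x) mulrA xx mul0r. Qed.

Lemma finite_repeat (T : finType) (f : nat -> T) :
  exists a, exists2 b, (0 < b)%N & f (a + b)%N = f a.
Proof.
have /injectivePn[i [j neq_ij eq_f]] :
    ~~ injectiveb (fun i : 'I_#|T|.+1 => f i).
  by apply/injectiveP => /leq_card; rewrite card_ord ltnn.
wlog lt_ij : i j neq_ij eq_f / (i < j)%N => [th|].
  case: (ltngtP i j) => [|lt_ji|eq_ij]; first exact: th.
    by apply: (th j i); rewrite // eq_sym.
  by rewrite (ord_inj eq_ij) eqxx in neq_ij.
by exists i, (j - i)%N; rewrite ?subn_gt0 // subnKC // ltnW.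
Qed.

(** Multiplication by [minv x] lowers every exponent above [1] by one. *)
Lemma expr_cancel (M : meadowType) (x : M) a b :
  x ^+ (a + b).+1 = x ^+ a.+1 -> x ^+ b.+1 = x.
Proof.
have drop c : x ^+ c.+2 * minv x = x ^+ c.+1.
  by rewrite !exprSr -!mulrA mulr_mulrV.
elim: a => [|a IHa] //; rewrite addSn => eq_x.
by apply: IHa; rewrite -drop eq_x drop.
Qed.

Lemma expr_period (M : finMeadowType) (x : M) :
  exists2 b, (0 < b)%N & x ^+ b.+1 = x.
Proof.
have [a [b b_gt0 eq_x]] := finite_repeat (fun i => x ^+ i.+1).
by exists b; last exact: (expr_cancel eq_x).
Qed.

(** If [x ^+ b.+1 = x] then exponents count modulo [b], so the inverse should
    be [x ^+ b.-1].  The proof uses the congruent exponent [b.*2.-1], which is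
    positive even when [b = 1]; this matters because [x ^+ 0] need not be the
    right power when [x] is not invertible. *)
Lemma minv_expr (M : finMeadowType) (x : M) : exists e, minv x = x ^+ e.
Proof.
have [[//|b] _ xb] := expr_period x; exists b.*2.+1.
have xbS c : x ^+ (c + b.+1).+1 = x ^+ c.+1.
  by rewrite -addnS exprD xb -exprSr.
symmetry; apply: minv_unique.
  rewrite -!exprS (_ : b.*2.+3 = (b.+1 + b.+1).+1) ?xbS ?xb //.
  by rewrite addSn addnS addnn.
rewrite -exprSr -exprD.
rewrite (_ : (b.*2.+1 + b.*2.+2)%N = ((b.*2 + b.+1) + b.+1).+1) ?xbS //.
by rewrite -addnA !(addnS, addSn) (addnn b).
Qed.

Lemma natr_modn (R : pzRingType) c m : c%:R = 0 :> R -> (m %% c)%:R = m%:R :> R.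
Proof. by move=> c0; rewrite {2}(divn_eq m c) natrD natrM c0 mulr0 add0r. Qed.

(** With truncated subtraction [(b - a) + (a - b)] is the distance of [a] and
    [b], so no case distinction on their order is needed at the uses. *)
Lemma natr_eq_char (R : pzRingType) (P : pred nat) a b :
    (forall m, (m%:R == 0 :> R) = P m) ->
  (a%:R == b%:R :> R) = P ((b - a) + (a - b))%N.
Proof.
move=> RP; case: (leqP a b) => [le_ab|/ltnW le_ba].
  by rewrite (eqP (le_ab : (a - b == 0)%N)) addn0 -RP natrB // subr_eq0 eq_sym.
by rewrite (eqP (le_ba : (b - a == 0)%N)) add0n -RP natrB // subr_eq0.
Qed.

Lemma char_exists (R : pzRingType) :
    (exists2 b, (0 < b)%N & b%:R = 0 :> R) ->
  exists2 c, (0 < c)%N & forall m, (m%:R == 0 :> R) = (c %| m)%N.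
Proof.
case=> b b_gt0 /eqP b0.
have ex_c : exists c, (0 < c)%N && (c%:R == 0 :> R) by exists b; rewrite b_gt0.
case: (ex_minnP ex_c) => c /andP[c_gt0 /eqP c0] c_min; exists c => // m.
rewrite -(natr_modn m c0) /dvdn; case: posnP => [->|mc_gt0]; first exact/eqP.
apply/negbTE/negP => mc0; have := c_min (m %% c)%N.
by rewrite mc_gt0 mc0 leqNgt ltn_pmod // => /(_ isT).
Qed.

(** By finiteness both [- x] and [minv x] are obtained from [x] by sums and
    products, so the multiples of [1] form a submeadow. *)
Lemma minimal_natr (M : finMeadowType) c (x : M) :
    minimal_meadow M -> (0 < c)%N -> c%:R = 0 :> M ->
  exists i : 'I_c, x = i%:R.
Proof.
move=> minM c_gt0 c0.
pose S y := [exists i : 'I_c, y == i%:R :> M].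
have SN m : S m%:R.
  apply/existsP; exists (Ordinal (ltn_pmod m c_gt0)) => /=.
  by rewrite natr_modn.
have SE y : S y -> exists m, y = m%:R by case/existsP=> i /eqP->; exists i.
have [|nSx] := boolP (S x); first by case/existsP=> i /eqP ->; exists i.
case: minM; exists (fun y => S y).
split; last by exists x => Sx; rewrite Sx in nSx.
split=> [||_ _ /SE[a ->] /SE[b ->]|_ /SE[a ->]|_ _ /SE[a ->] /SE[b ->]|_ /SE[a ->]].
- exact: (SN 0%N).
- exact: (SN 1%N).
- by rewrite -natrD.
- (* As [c * a] is a multiple of [c], adding [a] to [c * a - a] gives [0]. *)
  rewrite (_ : - a%:R = (c * a - a)%:R) // natrB ?leq_pmull //.
  by rewrite natrM c0 mul0r sub0r.
- by rewrite -natrM.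
by have [e ->] := minv_expr (a%:R : M); rewrite -natrX.
Qed.

(** If [c] is the characteristic then [i |-> i%:R] is a bijection from ['I_c]
    to [M], hence [c = #|M|]. *)
Lemma minimal_natr_eq0 (M : finMeadowType) :
    minimal_meadow M -> forall m, (m%:R == 0 :> M) = (#|M| %| m)%N.
Proof.
move=> minM.
have [a [b b_gt0 /eqP]] := finite_repeat (fun i => i%:R : M).
rewrite natrD -subr_eq0 addrAC subrr add0r => /eqP b0.
have [|c c_gt0 cP] := @char_exists M; first by exists b.
have /eqP c0 : c%:R == 0 :> M by rewrite cP.
pose f (i : 'I_c) : M := i%:R.
have f_inj : injective f.
  move=> i j /eqP; rewrite (natr_eq_char _ _ cP) => c_dvd; apply/ord_inj.
  have lt_c : (j - i + (i - j) < c)%N.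
    case: (leqP i j) => [le_ij|/ltnW le_ji].
      by rewrite (eqP le_ij) addn0 (leq_ltn_trans (leq_subr _ _)).
    by rewrite (eqP le_ji) (leq_ltn_trans (leq_subr _ _)).
  have: (j - i + (i - j) == 0)%N.
    by move: c_dvd; rewrite /dvdn modn_small.
  by rewrite addn_eq0 => /andP[le_ji le_ij]; apply/eqP; rewrite eqn_leq; apply/andP.
suff -> : #|M| = c by [].
rewrite -(card_ord c) -(card_codom f_inj); apply: eq_card => x.
by have [i ->] := minimal_natr x minM c_gt0 c0; rewrite -/(f i) codom_f.
Qed.

Lemma finMeadow_gt0 (M : finMeadowType) : (0 < #|M|)%N.
Proof. by apply/card_gt0P; exists (0 : M). Qed.

(** Were [p ^ 2] to divide [#|M|], the element [#|M| %/ p] would be nonzero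
    with square zero. *)
Lemma minimal_logn (M : finMeadowType) p :
  minimal_meadow M -> p \in primes #|M| -> logn p #|M| = 1%N.
Proof.
move=> minM; have n_gt0 := finMeadow_gt0 M.
rewrite -logn_gt0 => log_gt0; apply/eqP; rewrite eqn_leq log_gt0 andbT leqNgt.
have := log_gt0; rewrite logn_gt0 mem_primes => /and3P[p_pr _ _].
rewrite -pfactor_dvdn //; apply/negP => /dvdnP[q n_eq].
have /eqP : (q * p)%:R = 0 :> M.
  apply/sqr_eq0/eqP; rewrite -natrM minimal_natr_eq0 // n_eq.
  by rewrite mulnACA (mulnn p) -mulnA dvdn_mull.
rewrite minimal_natr_eq0 // n_eq -mulnn mulnA => /dvdn_leq.
have qp_gt0 : (0 < q * p)%N.
  by rewrite muln_gt0 (prime_gt0 p_pr) andbT; case: q n_eq n_gt0 => // ->.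
by move/(_ qp_gt0); rewrite leqNgt ltn_Pmulr ?prime_gt1.
Qed.

(** The map sends [m%:R] in [M] to [m%:R] in [N]; the last hypothesis makes it
    well defined and injective, and the cardinalities make it bijective.  The
    size of [N] is expressed by a bijection with a finite type [T], so that the
    lemma applies to a product of meadows, which is declared as a meadow but
    not as a finite one. *)
Lemma minimal_isomorphic (M : finMeadowType) (N : meadowType)
    (T : finType) (g : N -> T) (h : T -> N) :
    minimal_meadow M -> cancel g h -> cancel h g -> #|T| = #|M| ->
    (forall m, (m%:R == 0 :> N) = (#|M| %| m)%N) ->
  isomorphic_meadows M N.
Proof.
move=> minM gK hK cardT NP; have MP := minimal_natr_eq0 minM.
have natr_ex (x : M) : exists m, x == m%:R.
  have /eqP n0 : #|M|%:R == 0 :> M by rewrite MP.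
  by have [i ->] := minimal_natr x minM (finMeadow_gt0 M) n0; exists i.
pose f x : N := (xchoose (natr_ex x))%:R.
have natr_MN a b : (a%:R == b%:R :> M) = (a%:R == b%:R :> N).
  by rewrite (natr_eq_char _ _ MP) (natr_eq_char _ _ NP).
have fE m : f m%:R = m%:R.
  by apply/eqP; rewrite -natr_MN eq_sym; exact: (xchooseP (natr_ex m%:R)).
have elt (x : M) : exists m, x = m%:R by have [m /eqP] := natr_ex x; exists m.
have f_inj : injective f.
  move=> x y; have [[a ->] [b ->]] := (elt x, elt y).
  by rewrite !fE => /eqP; rewrite -natr_MN => /eqP.
have f0 : f 0 = 0 by exact: (fE 0%N).
have fD : {morph f : x y / x + y}.
  by move=> x y; have [[a ->] [b ->]] := (elt x, elt y); rewrite -natrD !fE natrD.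
have fM : {morph f : x y / x * y}.
  by move=> x y; have [[a ->] [b ->]] := (elt x, elt y); rewrite -natrM !fE natrM.
exists f; split=> // [||x|x].
- have gf_inj : injective (g \o f) by apply: inj_comp f_inj; exact: can_inj gK.
  have gf_bij : bijective (g \o f) by apply: inj_card_bij; rewrite ?cardT.
  apply: (eq_bij (bij_comp (Bijective hK gK) gf_bij)) => x /=.
  exact: gK.
- exact: (fE 1%N).
- by apply/eqP; rewrite -subr_eq0 opprK -fD addNr f0.
apply: minv_unique; first by rewrite -!fM mulr_mulrV.
by rewrite -!fM -{3}(minvK x) mulr_mulrV.
Qed.

Lemma meadow_prod_natr (I : finType) (T : I -> meadowType) m (i : I) :
  (m%:R : meadow_prod T) i = m%:R.
Proof.
by elim: m => [|m IHm]; rewrite ?mulr0n ?ffunE // !mulrS ffunE IHm ffunE.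
Qed.

Lemma natr_Zmodp_eq0 p m : prime p -> (m%:R == 0 :> Zmodp p) = (p %| m)%N.
Proof. by move=> p_pr; rewrite (dvdn_pcharf (pchar_Fp p_pr)). Qed.

End Meadows.

Theorem corollary2p9 :
  (forall (M : finMeadowType) (n : nat),
     minimal_meadow M -> #|M| = n ->
     exists (k : nat) (p : 'I_k -> nat),
       [/\ injective p,
           forall i : 'I_k, prime (p i),
           isomorphic_meadows M (meadow_prod (fun i : 'I_k => Zmodp (p i)))
         & n = \prod_(i < k) p i])
  /\
  (forall M N : finMeadowType,
     minimal_meadow M -> minimal_meadow N -> #|M| = #|N| ->
     isomorphic_meadows M N).
Proof.
split=> [M n minM cardM|M N minM minN eq_MN]; last first.
  apply: (@minimal_isomorphic M N N id id) => // m.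
  by rewrite minimal_natr_eq0 // eq_MN.
have n_gt0 : 0 < n by rewrite -cardM finMeadow_gt0.
have log1 q : q \in primes n -> logn q n = 1.
  by rewrite -cardM; apply: minimal_logn.
pose p := tnth (in_tuple (primes n)).
have p_in i : p i \in primes n by apply: mem_tnth.
have p_pr i : prime (p i) by have := p_in i; rewrite mem_primes => /andP[].
have n_prod : n = \prod_(i < size (primes n)) p i.
  rewrite {1}(prod_prime_decomp n_gt0) prime_decompE big_map /=.
  rewrite -(big_tnth _ _ _ xpredT id).
  by apply: eq_big_seq => q /log1 ->; rewrite expn1.
exists (size (primes n)), p; split=> //.
  by apply/injectiveP; rewrite /injectiveb /dinjectiveb map_tnth_enum primes_uniq.
pose F := {dffun forall i : 'I_(size (primes n)), 'F_(p i)}.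
pose N : meadowType := meadow_prod (fun i => Zmodp (p i)).
apply: (@minimal_isomorphic M N F (fun x => x) (fun x => x)) => // [|m].
  rewrite cardM [RHS]n_prod card_dep_ffun foldrE big_image /=.
  by apply: eq_bigr => i _; apply: card_Fp.
rewrite cardM; apply/eqP/(dvdn_partP _ n_gt0) => [m0 q q_in|n_dvd].
  rewrite p_part log1 //.
  have /tnthP[i q_eq] : q \in in_tuple (primes n) by [].
  rewrite expn1 q_eq -natr_Zmodp_eq0 //; apply/eqP.
  by have := meadow_prod_natr (fun i => Zmodp (p i)) m i; rewrite m0 ffunE => <-.
apply/ffunP => i; rewrite meadow_prod_natr ffunE; apply/eqP.
by rewrite natr_Zmodp_eq0 //; have := n_dvd _ (p_in i); rewrite p_part log1 ?expn1.
Qed.
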